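(* Let $(X,\|\cdot\|)$ be a smooth normed plane. Then the norm is Radon if and only if $\mathrm{cm}(x,y)\cdot\mathrm{cm}(y,x)\ge 0$ for all $x,y\in X_o$.
   Context: A normed plane is a 2-dimensional real vector space $X$ with a norm $\|\cdot\|$; $o$ is the origin, $X_o=X\setminus\{o\}$, $S$ is the unit circle. The plane is smooth if the unit ball has exactly one supporting line at each point of $S$. Birkhoff orthogonality: $x\dashv_B y$ means $\|x+\lambda y\|\ge\|x\|$ for all $\lambda\in\mathbb{R}$. The norm (plane) is Radon if $\dashv_B$ is a symmetric relation. Fix a non-degenerate symplectic bilinear form $[\cdot,\cdot]$ on $X$ and define the antinorm $\|v\|_a=\sup\{|[v,w]|:w\in S\}$. In a smooth plane, for $x\in X_o$, $b(x)$ denotes the unique vector with $x\dashv_B b(x)$, $\|b(x)\|_a=1$ and $[x,b(x)]>0$. The cosine function is $\mathrm{cm}(x,y)=\dfrac{[y,b(x)]}{\|y\|}$ for $x,y\in X_o$ (it does not depend on the choice of the form). *)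

(* Defs.v *)
From HB Require Import structures.
From mathcomp Require Import all_boot all_order all_algebra.
From mathcomp Require Import all_classical all_reals all_analysis.

Set Implicit Arguments.
Unset Strict Implicit.
Unset Printing Implicit Defensive.

Import Order.TTheory GRing.Theory Num.Theory.
Import numFieldNormedType.Exports.

Local Open Scope classical_set_scope.
Local Open Scope ring_scope.

(* A finite-dimensional normed space; the library has no common structure for
   its finite-dimensional and its normed spaces.  A normed plane is an
   X : normedVectType R with \dim {:X} = 2. *)
#[short(type="normedVectType")]
HB.structure Definition NormedVect (R : numFieldType) :=
  {X of NormedModule R X & Vector R X}.

Section NormedPlane.
Variables (R : realType) (X : normedVectType R).
Implicit Types (x y v w p : X) (L : set X).

(* In a plane the lines are exactly the level sets of the non-zero linear
   functionals, and the half-planes bounded by [set v | f v = c] are given by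
   f <= c and f >= c; replacing (f, c) by (- f, - c) allows either side. *)
Definition supporting_line p L : Prop :=
  L p /\ exists (f : {scalar X}) (c : R),
    [/\ exists v, f v != 0,
        L = [set v | f v = c] &
        forall v, `|v| <= 1 -> f v <= c].

Definition smooth : Prop :=
  forall p, `|p| = 1 -> exists! L, supporting_line p L.

Definition birkhoff x y : Prop := forall l : R, `|x| <= `|x + l *: y|.

Definition radon : Prop := forall x y, birkhoff x y -> birkhoff y x.

Variable omega : {skew_symmetric X}.

Definition antinorm v : R := sup [set `|omega v w| | w in [set w | `|w| = 1]].

(* [xget] returns an element of the set if it is non-empty, and 0 otherwise; in
   a smooth plane with omega non-degenerate and x != 0 the set is a
   singleton. *)
Definition bvec x : X :=
  xget 0 [set v | [/\ birkhoff x v, antinorm v = 1 & 0 < omega x v]].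

Definition cm x y : R := omega y (bvec x) / `|y|.

End NormedPlane.

Arguments smooth {R} X.
Arguments radon {R} X.

(* Main.v *)
Require Import Defs.
From mathcomp Require Import all_boot all_order all_algebra.
From mathcomp Require Import all_classical all_reals all_analysis.
From mathcomp Require Import ring lra.

Set Implicit Arguments.
Unset Strict Implicit.
Unset Printing Implicit Defensive.

Import Order.TTheory GRing.Theory Num.Theory.

Local Open Scope ring_scope.

(** In a smooth plane [u |-> omega u (bvec x)] is the support functional of the
    norm at [x]: it is bounded by the norm, it attains the norm at [x], and its
    kernel consists of the [v] with [x] Birkhoff orthogonal to [v].  Smoothness
    supplies the existence of the supporting line as well as its uniqueness.

    If the norm is Radon, then [w := bvec x] is Birkhoff orthogonal to [x]; for
    [y = a x + l w] this gives [|l w| <= |y|], and evaluating the support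
    functional of [y] on [y - l w = a x] shows that [cm y x] has the sign of
    [a], which is the sign of [cm x y].

    Conversely let [x] be orthogonal to [y].  Then [cm x (y + t x)] has the sign
    of [t], hence so has, weakly, [cm (y + t x) x]; this is the slope of the
    convex function [t |-> |y + t x|], which is therefore minimal at [t = 0]. *)

(** * Birkhoff orthogonality and support functionals *)

Section BirkhoffOrthogonality.
Context {R : realType} {X : normedVectType R}.
Implicit Types (x y u v w : X) (a b : R).

Lemma birkhoffZ a b x v : birkhoff x v -> birkhoff (a *: x) (b *: v).
Proof.
move=> xv l; have [->|a0] := eqVneq a 0; first by rewrite scale0r normr0.
have -> : a *: x + l *: (b *: v) = a *: (x + (a^-1 * (l * b)) *: v).
  by rewrite scalerDr !scalerA mulVKf.
by rewrite !normrZ ler_wpM2l.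
Qed.

Lemma birkhoff_collinear x k : x != 0 -> birkhoff x (k *: x) -> k = 0.
Proof.
move=> x0 xkx; apply: contra_neq_eq x0 => k0.
have := xkx (- k^-1); rewrite scaleNr scalerA mulVf // scale1r subrr normr0.
by rewrite normr_le0 => /eqP.
Qed.

(** Applied to [v] and [- v], the bound gives [|f| <= c] on the unit ball, and a non-zero functional
    does not vanish on the whole ball. *)
Lemma supporting_level_gt0 p (f : {scalar X}) c :
  `|p| = 1 -> f p = c -> (exists v, f v != 0) ->
  (forall v, `|v| <= 1 -> f v <= c) -> 0 < c.
Proof.
move=> p1 fp [v fv] fc.
have fNc u : `|u| <= 1 -> `|f u| <= c.
  by move=> u1; rewrite ler_norml fc // andbT lerNl -linearN fc // normrN.
have v0 : v != 0 by apply: contraNneq fv => ->; rewrite linear0.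
have := fNc (`|v|^-1 *: v); rewrite normrZ normfV normr_id mulVf ?normr_eq0 //.
move/(_ (lexx _)); apply: lt_le_trans.
by rewrite linearZ normr_gt0 mulf_neq0 // invr_eq0 normr_eq0.
Qed.

Lemma supporting_bound (f : {scalar X}) c u :
  (forall v, `|v| <= 1 -> f v <= c) -> f u <= c * `|u|.
Proof.
move=> fc; have [->|u0] := eqVneq u 0; first by rewrite linear0 normr0 mulr0.
rewrite -ler_pdivrMr ?normr_gt0 // mulrC -linearZ fc //.
by rewrite normrZ normfV normr_id mulVf ?normr_eq0.
Qed.

End BirkhoffOrthogonality.

(** * Coordinates given by a skew-symmetric form *)

Section SkewForm.
Context {R : realType} {X : normedVectType R} {omega : {skew_symmetric X}}.
Implicit Types (x y z u v : X).

Lemma omega_skew x y : omega x y = - omega y x.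
Proof. by rewrite hermC expr1 mulN1r. Qed.

Lemma omega_diag x : omega x x = 0.
Proof. by have := omega_skew x x; lra. Qed.

Lemma omegaDr x y z : omega x (y + z) = omega x y + omega x z.
Proof. by rewrite linearDr. Qed.

Lemma omegaDl x y z : omega (x + y) z = omega x z + omega y z.
Proof. by rewrite linearDl. Qed.

Lemma omegaZr a x y : omega x (a *: y) = a * omega x y.
Proof. by rewrite linearZr_LR. Qed.

Lemma omegaZl a x y : omega (a *: x) y = a * omega x y.
Proof. by rewrite linearZl_LR. Qed.

Definition omegaE := (omegaDl, omegaDr, omegaZl, omegaZr, omega_diag).

(** Cramer's rule: [x] and [v] form a basis, and pairing with [v] and with [x] reads off the two
    coordinates. *)
Lemma omega_expansion x v u : \dim {:X} = 2%N -> omega x v != 0 ->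
  u = (omega u v / omega x v) *: x + (omega x u / omega x v) *: v.
Proof.
move=> dim2 xv.
have v0 : v != 0 by apply: contraNneq xv => ->; rewrite linear0r.
have bas : basis_of {:X} [:: x; v].
  rewrite basisEfree subvf dim2 !andbT free_cons seq1_free v0 andbT span_seq1.
  by apply: contra xv => /vlineP[k ->]; rewrite omegaZl omega_diag mulr0.
have : u \in <<[:: x; v]>>%VS by rewrite (span_basis bas) memvf.
rewrite span_cons span_seq1.
case/memv_addP => _ /vlineP[a ->] [_ /vlineP[b ->] ->].
by rewrite !omegaE !mulr0 addr0 add0r !mulfK.
Qed.

Lemma omega_nondegenerate x :
  is_psymplectic omega -> x != 0 -> exists q, omega x q != 0.
Proof.
case=> /eqP nd _ _ x0.
have /mem_orthovPn[q _ xq] : x \notin orthov omega fullv by rewrite nd memv0.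
by exists q.
Qed.

End SkewForm.

(** * Birkhoff orthogonality in terms of the symplectic form *)

Section SymplecticPlane.
Context {R : realType} {X : normedVectType R} {omega : {skew_symmetric X}}.
Hypotheses (dim2 : \dim {:X} = 2%N) (symp : is_psymplectic omega).
Implicit Types (x y u v w : X).

Lemma omega_eq0_collinear x v :
  x != 0 -> omega x v = 0 -> exists k, v = k *: x.
Proof.
move=> x0 xv; have [q xq] := omega_nondegenerate symp x0.
exists (omega v q / omega x q).
by rewrite {1}(omega_expansion v dim2 xq) xv mul0r scale0r addr0.
Qed.

Lemma birkhoff_omega_neq0 x v :
  x != 0 -> v != 0 -> birkhoff x v -> omega x v != 0.
Proof.
move=> x0 v0 xv; apply/eqP => /(omega_eq0_collinear x0)[k vk].
move: xv v0; rewrite vk => /(birkhoff_collinear x0) ->.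
by rewrite scale0r eqxx.
Qed.

(** In the expansion of [u] along [x] and [v], orthogonality makes the norm of the [x]-component at
    most that of [u]. Equality at [u = x] makes the constant the dual norm of [omega ^~ v]. *)
Lemma birkhoff_omega_le x v u : x != 0 -> birkhoff x v ->
  `|omega u v| <= `|omega x v| / `|x| * `|u|.
Proof.
move=> x0 xv; have [->|v0] := eqVneq v 0.
  by rewrite !linear0r normr0 !mul0r.
have xv0 := birkhoff_omega_neq0 x0 v0 xv.
have := birkhoffZ (omega u v / omega x v) (omega x u / omega x v) xv 1.
rewrite scale1r -omega_expansion // normrZ normrM normfV => le_u.
rewrite mulrAC ler_pdivlMr ?normr_gt0 // [leRHS]mulrC.
rewrite -ler_pdivrMr ?normr_gt0 //.
by rewrite mulrAC.
Qed.

Lemma birkhoff_antinorm x v : x != 0 -> birkhoff x v ->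
  antinorm omega v = `|omega x v| / `|x|.
Proof.
move=> x0 xv; have nx0 : 0 < `|x| by rewrite normr_gt0.
have ub : ubound [set `|omega v w| | w in [set w : X | `|w| = 1]]%classic
            (`|omega x v| / `|x|).
  move=> _ [w /= w1 <-]; rewrite omega_skew normrN.
  by rewrite (le_trans (birkhoff_omega_le w x0 xv)) // w1 mulr1.
have mem : [set `|omega v w| | w in [set w : X | `|w| = 1]]%classic
             (`|omega x v| / `|x|).
  exists (`|x|^-1 *: x) => /=.
    by rewrite normrZ normfV normr_id mulVf // gt_eqF.
  by rewrite omega_skew normrN omegaZl normrM normfV normr_id mulrC.
apply/eqP; rewrite eq_le; apply/andP; split.
  by apply: ge_sup => //; exists (`|omega x v| / `|x|).
by apply: ub_le_sup => //; exists (`|omega x v| / `|x|).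
Qed.

Lemma birkhoff_supporting_line x v : x != 0 -> birkhoff x v -> 0 < omega x v ->
  supporting_line (`|x|^-1 *: x)
    [set u | omega u v = omega (`|x|^-1 *: x) v]%classic.
Proof.
move=> x0 xv xv0; split=> //.
exists (applyr omega v : {scalar X}), (omega (`|x|^-1 *: x) v); split=> //.
  by exists x; rewrite gt_eqF.
move=> u u1; rewrite (le_trans (ler_norm _)) //.
rewrite (le_trans (birkhoff_omega_le u x0 xv)) //.
rewrite omegaZl (gtr0_norm xv0) [leRHS]mulrC.
by rewrite ler_piMr // divr_ge0 // ltW.
Qed.

(** * Uniqueness and existence of the orthogonal direction in a smooth plane *)

Hypothesis sm : smooth X.

Lemma birkhoff_unique x v w : x != 0 -> v != 0 -> w != 0 ->
  birkhoff x v -> birkhoff x w -> omega v w = 0.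
Proof.
move=> x0.
(* Replacing [v] or [w] by its opposite changes neither orthogonality nor the vanishing of
   [omega v w], so both can be oriented positively against [x]. *)
wlog xv0 : v / 0 < omega x v.
  move=> wl v0 w0 xv xw; have := birkhoff_omega_neq0 x0 v0 xv.
  rewrite neq_lt => /orP[xv_lt|xv_gt]; last exact: wl.
  apply/eqP; rewrite -oppr_eq0 -linearNl; apply/eqP/wl => //.
  - by rewrite linearNr oppr_gt0.
  - by rewrite oppr_eq0.
  - by move: (birkhoffZ 1 (-1) xv); rewrite scale1r scaleN1r.
wlog xw0 : w / 0 < omega x w.
  move=> wl v0 w0 xv xw; have := birkhoff_omega_neq0 x0 w0 xw.
  rewrite neq_lt => /orP[xw_lt|xw_gt]; last exact: wl.
  apply/eqP; rewrite -oppr_eq0 -linearNr; apply/eqP/wl => //.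
  - by rewrite linearNr oppr_gt0.
  - by rewrite oppr_eq0.
  - by move: (birkhoffZ 1 (-1) xw); rewrite scale1r scaleN1r.
move=> v0 w0 xv xw; have nx : `| `|x|^-1 *: x| = 1.
  by rewrite normrZ normfV normr_id mulVf ?normr_eq0.
have [L [_ uniqL]] := sm nx.
have Lv := uniqL _ (birkhoff_supporting_line x0 xv xv0).
have Lw := uniqL _ (birkhoff_supporting_line x0 xw xw0).
(* The supporting lines in the directions [v] and [w] coincide, so moving along [v] stays on the
   level line of [omega ^~ w]. *)
have : L (`|x|^-1 *: x + v) by rewrite Lv /= omegaDl omega_diag addr0.
by rewrite Lw /= omegaDl => /eqP; rewrite addrC -subr_eq0 addrK => /eqP.
Qed.

Lemma bvec_spec x : x != 0 ->
  [/\ birkhoff x (bvec omega x), antinorm omega (bvec omega x) = 1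
    & 0 < omega x (bvec omega x)].
Proof.
move=> x0; apply: (@xgetPex _ _ [set v | [/\ birkhoff x v, antinorm omega v = 1
  & 0 < omega x v]]%classic).
have nx0 : 0 < `|x| by rewrite normr_gt0.
have nx : `| `|x|^-1 *: x| = 1.
  by rewrite normrZ normfV normr_id mulVf // gt_eqF.
have [L [[Lp [f [c [fn0 LE fc]]]] _]] := sm nx.
have fp : f (`|x|^-1 *: x) = c by move: Lp; rewrite LE.
have c0 := supporting_level_gt0 nx fp fn0 fc.
have fx : f x = c * `|x|.
  by rewrite -fp linearZ /= mulrAC mulVf ?mul1r // gt_eqF.
have [q xq] := omega_nondegenerate symp x0.
(* The projection of [q] along [x] onto the kernel of the support functional; it keeps the value
   [omega x q], hence is non-zero. *)
pose w := q - (f q / f x) *: x.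
have fw : f w = 0.
  by rewrite linearB linearZ /= divfK ?subrr // fx mulf_neq0 ?gt_eqF.
have xw : omega x w != 0 by rewrite /w -scaleNr !omegaE mulr0 addr0.
have bxw : birkhoff x w.
  move=> l; rewrite -(ler_pM2l c0) -fx.
  have -> : f x = f (x + l *: w) by rewrite linearD linearZ /= fw mulr0 addr0.
  exact: supporting_bound.
have bxkw k : birkhoff x (k *: w) by have := birkhoffZ 1 k bxw; rewrite scale1r.
(* This scaling makes the pairing with [x] equal to the norm of [x], which by [birkhoff_antinorm]
   means antinorm 1. *)
exists ((`|x| / omega x w) *: w); split=> //.
  by rewrite (birkhoff_antinorm x0) // omegaZr divfK // normr_id divff // gt_eqF.
by rewrite omegaZr divfK.
Qed.

Lemma bvec_neq0 x : x != 0 -> bvec omega x != 0.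
Proof.
by case/bvec_spec => _ _; apply: contraTneq => ->; rewrite linear0r ltxx.
Qed.

Lemma omega_bvec_diag x : x != 0 -> omega x (bvec omega x) = `|x|.
Proof.
move=> x0; have [xb b1 xb0] := bvec_spec x0.
move: b1; rewrite (birkhoff_antinorm x0 xb) (gtr0_norm xb0) .
by move/(congr1 ( *%R^~ `|x|)); rewrite divfK ?mul1r // normr_eq0.
Qed.

Lemma omega_bvec_le x u : x != 0 -> omega u (bvec omega x) <= `|u|.
Proof.
move=> x0; have [xb _ _] := bvec_spec x0.
apply: (le_trans (ler_norm _)); apply: (le_trans (birkhoff_omega_le u x0 xb)).
by rewrite omega_bvec_diag // normr_id divff ?normr_eq0 // mul1r.
Qed.

Lemma omega_bvec_birkhoff x v :
  x != 0 -> birkhoff x v -> omega v (bvec omega x) = 0.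
Proof.
move=> x0 xv; have [->|v0] := eqVneq v 0; first by rewrite linear0l.
have [xb _ _] := bvec_spec x0.
by apply: (birkhoff_unique x0) => //; apply: bvec_neq0.
Qed.

(** * The sign of the cosine and the Radon property *)

Lemma cm_mul_ge0 x y : x != 0 -> y != 0 ->
  (0 <= cm omega x y * cm omega y x) =
  (0 <= omega y (bvec omega x) * omega x (bvec omega y)).
Proof.
move=> x0 y0; rewrite /cm mulrACA -invfM pmulr_lge0 //.
by rewrite invr_gt0 mulr_gt0 ?normr_gt0.
Qed.

Lemma radon_cm_ge0 x y : radon X -> x != 0 -> y != 0 ->
  0 <= cm omega x y * cm omega y x.
Proof.
move=> rad x0 y0; rewrite cm_mul_ge0 //.
have nx0 : 0 < `|x| by rewrite normr_gt0.
have [/rad bx _ xb0] := bvec_spec x0.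
have := omega_expansion y dim2 (lt0r_neq0 xb0).
rewrite omega_bvec_diag //.
set a := omega y _; set l := omega x y / _ => yE.
have := birkhoffZ l (a / `|x|) bx 1; rewrite scale1r addrC -yE => le_y.
(* The support functional at [y] is at most [|y|] on the [bvec omega x] component of [y] and equals
   [|y|] on [y], so it is non-negative on the remaining multiple of [x]. *)
have := le_trans (omega_bvec_le (l *: bvec omega x) y0) le_y.
rewrite -(omega_bvec_diag y0) {2}yE omegaDl lerDr omegaZl.
by rewrite mulrAC pmulr_lge0 ?invr_gt0.
Qed.

Lemma cm_ge0_radon :
  (forall x y, x != 0 -> y != 0 -> 0 <= cm omega x y * cm omega y x) ->
  radon X.
Proof.
move=> cm0 x y xy t.
have [->|x0] := eqVneq x 0; first by rewrite scaler0 addr0.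
have nx0 : 0 < `|x| by rewrite normr_gt0.
have [->|t0] := eqVneq t 0; first by rewrite scale0r addr0.
(* At [y] itself the hypothesis says nothing, since [cm omega x y] vanishes there. The slope is
   taken at the nearby point [y'], at the cost of an error that tends to 0 with [d]. *)
have slope d : 0 < d -> d < 1 -> `|y| - d * (`|t| * `|x|) <= `|y + t *: x|.
  move=> d0 d1; pose y' := y + (d * t) *: x.
  have y'x : omega y' (bvec omega x) = d * t * `|x|.
    by rewrite omegaDl omegaZl omega_bvec_birkhoff // add0r omega_bvec_diag.
  have y'0 : y' != 0.
    apply: contra_eqN y'x => /eqP ->; rewrite linear0l eq_sym.
    by rewrite !mulf_neq0 // gt_eqF.
  have := cm0 x y' x0 y'0; rewrite cm_mul_ge0 // y'x.
  rewrite mulrAC pmulr_lge0 // -mulrA pmulr_rge0 // => slope_ge0.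
  have := omega_bvec_le (y + t *: x) y'0.
  (* The support functional at [y'] gives the norm of [y'] plus a non-negative term for the
     remaining multiple of [x]. *)
  have -> : y + t *: x = y' + ((1 - d) * t) *: x.
    by rewrite -addrA -scalerDl; congr (_ + _ *: _); ring.
  rewrite omegaDl omegaZl omega_bvec_diag //; apply: le_trans.
  have : `|y| <= `|y'| + `|(d * t) *: x|.
    by rewrite -[X in `|X| <= _](addrK ((d * t) *: x)) ler_normB.
  rewrite normrZ normrM (gtr0_norm d0) -mulrA => tri.
  have : 0 <= (1 - d) * t * omega x (bvec omega y').
    by rewrite -mulrA mulr_ge0 // subr_ge0 ltW.
  lra.
rewrite leNgt; apply/negP => lt_y.
have tx0 : 0 < `|t| * `|x| by rewrite mulr_gt0 // normr_gt0.
pose e := `|y| - `|y + t *: x|.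
have e0 : 0 < e by rewrite subr_gt0.
have s0 : 0 < e + `|t| * `|x| by rewrite addr_gt0.
(* For this [d] in (0, 1) the error [d * (|t| * |x|)] is less than the assumed gap [e],
   contradicting [slope]. *)
have d0 : 0 < e / (e + `|t| * `|x|) by rewrite divr_gt0.
have d1 : e / (e + `|t| * `|x|) < 1 by rewrite ltr_pdivrMr // mul1r ltrDl.
have := slope _ d0 d1; rewrite lerBlDr -lerBlDl -/e mulrAC.
by rewrite ler_pdivlMr // mulrDr gerDr leNgt mulr_gt0.
Qed.

End SymplecticPlane.

Theorem proposition4p2p1 (R : realType) (X : normedVectType R)
    (omega : {skew_symmetric X}) :
  \dim {:X} = 2%N -> is_psymplectic omega -> smooth X ->
  (radon X <->
   forall x y : X, x != 0 -> y != 0 -> 0 <= cm omega x y * cm omega y x).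
Proof.
move=> dim2 symp sm; split; last exact: cm_ge0_radon.
by move=> rad x y; apply: radon_cm_ge0.
Qed.
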